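(* Let $\mu>0$, $\sigma\ge0$ and $r=\sigma/\mu$. Let $A$ be the log-lottery $P^{\log}_{\mu,\sigma}$ (a single-item mechanism posting a random price). Then for every $F\in\mathbb{F}_{\mu,\sigma}$, \[\frac{\mathrm{OPT}(F)}{\mathrm{REV}(A;F)}\le \rho(r),\] where $\rho(r)$ is the unique positive solution $\rho$ of $\frac{1}{\rho^2}\left(2e^{\rho-1}-1\right)=r^2+1$. In particular the robust approximation ratio satisfies $\mathrm{APX}(\mu,\sigma)\le\rho(r)$.
   Context: A nonnegative real random variable is $(\mu,\sigma)$-distributed if its expectation is $\mu$ and its standard deviation is at most $\sigma$; $\mathbb{F}_{\mu,\sigma}$ is the class of such distributions. Single item, single buyer with value $X\sim F$. A (possibly randomized) truthful mechanism is identified with a probability distribution $A$ over prices $p\ge0$: a price $p\sim A$ is drawn and the buyer buys iff $X\ge p$. $\mathrm{REV}(p;F)=p\Pr[X\ge p]$, $\mathrm{REV}(A;F)=\mathbb{E}_{p\sim A}[\mathrm{REV}(p;F)]$, $\mathrm{OPT}(F)=\sup_{p\ge0}\mathrm{REV}(p;F)$, and $\mathrm{APX}(\mu,\sigma)=\inf_A\sup_{F\in\mathbb{F}_{\mu,\sigma}}\mathrm{OPT}(F)/\mathrm{REV}(A;F)$ (ratios with zero denominator are $+\infty$). The log-lottery $P^{\log}_{\mu,\sigma}$ is the random price supported on $[\pi_1,\pi_2]$ with cdf $x\mapsto\frac{\pi_2\ln(x/\pi_1)-(x-\pi_1)}{\pi_2\ln(\pi_2/\pi_1)-(\pi_2-\pi_1)}$,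 where $0<\pi_1\le\pi_2$ are the unique solutions of $\pi_1(1+\ln(\pi_2/\pi_1))=\mu$ and $\pi_1(2\pi_2-\pi_1)=\mu^2+\sigma^2$ (when $\sigma=0$, $\pi_1=\pi_2=\mu$ and it is the deterministic price $\mu$). *)

(* Defs.v *)
From HB Require Import structures.
From mathcomp Require Import all_boot all_order all_algebra.
From mathcomp Require Import all_classical all_reals all_analysis.
Set Implicit Arguments. Unset Strict Implicit. Unset Printing Implicit Defensive.
Import Order.TTheory GRing.Theory Num.Theory.
Import numFieldNormedType.Exports.
Local Open Scope classical_set_scope.
Local Open Scope ring_scope.

Section Robust.
Variable R : realType.

Definition in_class (mu sigma : R) (F : probability R R) : Prop :=
  F `]-oo, 0[%classic = 0%E /\
  (\int[F]_x (x%:E) = mu%:E)%E /\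
  (\int[F]_x (((x - mu) ^+ 2)%:E) <= (sigma ^+ 2)%:E)%E.

Definition REVp (p : R) (F : probability R R) : R :=
  p * fine (F `[p, +oo[%classic).

Definition OPT (F : probability R R) : R :=
  sup [set REVp p F | p in `[0, +oo[%classic].

Definition REV (A F : probability R R) : R :=
  fine (\int[A]_p ((REVp p F)%:E))%E.

Definition rev_ratio (o v : R) : \bar R :=
  if v == 0 then +oo%E else (o / v)%:E.

Definition APX (mu sigma : R) : \bar R :=
  ereal_inf [set x | exists A : probability R R,
    A `]-oo, 0[%classic = 0%E /\
    x = ereal_sup [set y | exists F : probability R R,
                            in_class mu sigma F /\ y = rev_ratio (OPT F) (REV A F)]].

(* cdf of the log-lottery on [pi1, pi2]; when pi1 = pi2 it is the
   cdf of the deterministic price pi1. *)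
Definition log_cdf (pi1 pi2 x : R) : R :=
  if x < pi1 then 0
  else if pi2 <= x then 1
  else (pi2 * ln (x / pi1) - (x - pi1)) /
       (pi2 * ln (pi2 / pi1) - (pi2 - pi1)).

End Robust.

(* Main.v *)
(* By Markov's inequality OPT F <= mu, so it suffices that the lottery earns at
   least pi1, since mu / pi1 = 1 + ln (pi2 / pi1) solves the equation for rho,
   whose left-hand side is strictly increasing.  By Fubini the revenue is
   the mean over X ~ F of the expected payment of a buyer of value X, and this
   payment dominates the parabola
     q(x) = (pi2 (x - pi1) - (x^2 - pi1^2) / 2) / D,
     D = pi2 ln (pi2 / pi1) - (pi2 - pi1).
   The two equations on pi1 and pi2 give E[q(X)] >= pi1 whenever E X = mu and
   Var X <= sigma^2.  When pi1 = pi2, both F and the lottery are point masses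
   at mu. *)
Require Import Defs.
From HB Require Import structures.
From mathcomp Require Import all_boot all_order all_algebra.
From mathcomp Require Import all_classical all_reals all_analysis.
From mathcomp Require Import measurable_realfun ring lra.
Import Order.TTheory GRing.Theory Num.Theory.
Import numFieldNormedType.Exports.
Local Open Scope classical_set_scope.
Local Open Scope ring_scope.

(** * Monotonicity from a quadratic bound on the increments *)

(* Subdividing [a, b] into n equal parts turns the hypothesis into
   f b - f a >= - C (b - a)^2 / n. *)
Lemma quadratic_defect_le {R : realType} (f : R -> R) (C a b : R) : a <= b ->
  (forall x y, a <= x -> x <= y -> y <= b -> - (C * (y - x) ^+ 2) <= f y - f x) ->
  f a <= f b.
Proof.
move=> ab fC; rewrite leNgt; apply/negP => fba.
(* With [n.+1] parts the total defect is C (b - a)^2 / (n + 1), which drops below the supposed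
   decrease f a - f b. *)
have [n nP] : exists n : nat, C * (b - a) ^+ 2 < (f a - f b) * n.+1%:R.
  have fab0 : 0 < f a - f b by rewrite subr_gt0.
  exists (Num.truncn (C * (b - a) ^+ 2 / (f a - f b))).
  by rewrite -ltr_pdivrMl // mulrC truncnS_gt.
have n0 : 0 < n.+1%:R :> R by rewrite ltr0n.
pose h := (b - a) / n.+1%:R; pose t (i : nat) := a + i%:R * h.
have h0 : 0 <= h by rewrite divr_ge0 ?subr_ge0 // ltW.
have hn : n.+1%:R * h = b - a by rewrite /h mulrC divfK // gt_eqF.
have tE i : t i.+1 - t i = h by rewrite /t -natr1; ring.
have step i : (i < n.+1)%N -> - (C * h ^+ 2) <= f (t i.+1) - f (t i).
  move=> ltin; rewrite -{1}(tE i); apply: fC.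
  - by rewrite lerDl mulr_ge0 ?ler0n.
  - by rewrite -subr_ge0 tE.
  - by rewrite /t -lerBrDl -hn ler_wpM2r // ler_nat.
have sumE : \sum_(0 <= i < n.+1) (f (t i.+1) - f (t i)) = f b - f a.
  by rewrite (telescope_sumr (fun i => f (t i))) // /t hn mul0r addr0 addrCA subrr addr0.
have : \sum_(0 <= i < n.+1) (- (C * h ^+ 2)) <= f b - f a.
  by rewrite -sumE !big_mkord; apply: ler_sum => i _; apply: step.
rewrite sumr_const_nat subn0 -mulr_natr => le1.
have : - (C * h ^+ 2) * n.+1%:R * n.+1%:R <= (f b - f a) * n.+1%:R.
  by rewrite ler_wpM2r // ltW.
have -> : - (C * h ^+ 2) * n.+1%:R * n.+1%:R = - (C * (b - a) ^+ 2).
  by rewrite -hn; ring.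
lra.
Qed.

(** * Strict monotonicity of the equation for rho *)

(* The left-hand side of the equation defining rho. *)
Definition ratio_fun {R : realType} (x : R) : R :=
  (x ^+ 2)^-1 * (2 * expR (x - 1) - 1).

Lemma is_derive_ratio_fun {R : realType} (x : R) : 0 < x ->
  is_derive x 1 (@ratio_fun R)
    (2 * (x ^+ 3)^-1 * (expR (x - 1) * (x - 2) + 1)).
Proof.
move=> x0; have xN0 : x != 0 by rewrite gt_eqF.
have x2N0 : x ^+ 2 != 0 by rewrite expf_neq0.
rewrite /ratio_fun.
have E1 : is_derive x 1 (fun y : R => 2 * expR (y - 1) - 1)
    (2 * expR (x - 1)).
  apply: is_derive_eq; rewrite /GRing.scale /=; ring.
have E2 : is_derive x 1 (fun y : R => (y ^+ 2)^-1) (- 2 * (x ^+ 3)^-1).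
  apply: is_derive_eq; rewrite /GRing.scale /=; field => //.
apply: is_derive_eq (is_deriveM E2 E1) _; rewrite /GRing.scale /=; field => //.
Qed.

(** With t = x - 1, the last factor is e^t (t - 1) + 1, positive because 1 - t < e^(-t) for t
    nonzero. *)
Lemma derive_ratio_fun_gt0 {R : realType} (x : R) : 0 < x -> x != 1 ->
  0 < 2 * (x ^+ 3)^-1 * (expR (x - 1) * (x - 2) + 1).
Proof.
move=> x0 x1; rewrite mulr_gt0 //; first by rewrite mulr_gt0 ?invr_gt0 ?exprn_gt0.
have : 1 + - (x - 1) < expR (- (x - 1)).
  by apply: expR_gt1Dx; rewrite oppr_eq0 subr_eq0.
rewrite expRN -(ltr_pM2l (expR_gt0 (x - 1))) mulfV ?gt_eqF ?expR_gt0 //.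
lra.
Qed.

(** The derivative vanishes at 1, so the mean value theorem is applied on either side of 1 and the
    two halves are chained there. *)
Lemma ratio_fun_mono {R : realType} (x y : R) : 0 < x -> x < y -> ratio_fun x < ratio_fun y.
Proof.
have half (a b : R) : 0 < a -> a < b -> (b <= 1) || (1 <= a) -> ratio_fun a < ratio_fun b.
  move=> a0 ab ab1.
  have pos z : z \in `[a, b] -> 0 < z.
    by rewrite in_itv /= => /andP[ax _]; exact: lt_le_trans ax.
  have [| |c] := @MVT R (@ratio_fun R)
    (fun z => 2 * (z ^+ 3)^-1 * (expR (z - 1) * (z - 2) + 1)) a b ab.
  - move=> z; rewrite in_itv /= => /andP[az zb].
    by apply: is_derive_ratio_fun; apply: lt_trans az.
  - apply: derivable_within_continuous => z xab.
    by have [] := is_derive_ratio_fun _ (pos _ xab).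
  rewrite in_itv /= => /andP[ac cb] E.
  rewrite -subr_gt0 E mulr_gt0 ?subr_gt0 // derive_ratio_fun_gt0 //.
    exact: lt_trans ac.
  by case/orP: ab1 => h; rewrite neq_lt ?(lt_le_trans cb h) // (le_lt_trans h ac) orbT.
move=> x0 xy.
have [y1|y1] := leP y 1; first by rewrite half // y1.
have [x1|x1] := leP 1 x; first by rewrite half // x1 orbT.
by apply: (@lt_trans _ _ (ratio_fun 1)); apply: half; rewrite ?lexx ?orbT ?ltr01.
Qed.

(** * Expected payment of a buyer of given value *)

(* Truncating the price at 0 makes the payment nonnegative; the lottery does
   not charge negative prices. *)
Definition payment {R : realType} (p x : R) : R := if p <= x then Num.max p 0 else 0.

Definition mean_payment {R : realType} (A : probability R R) (x : R) : R :=
  fine (\int[A]_p (payment p x)%:E)%E.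

Lemma payment_ge0 {R : realType} (p x : R) : 0 <= payment p x.
Proof. by rewrite /payment; case: ifP => // _; rewrite le_max lexx orbT. Qed.

Lemma payment_le {R : realType} (p x : R) : payment p x <= `|x|.
Proof.
rewrite /payment; case: ifP => // px.
by rewrite ge_max normr_ge0 andbT (le_trans px) // ler_norm.
Qed.

Lemma measurable_payment2 {R : realType} :
  measurable_fun setT (fun z : R * R => payment z.1 z.2).
Proof.
rewrite /payment; apply: measurable_fun_ifT => //.
- by apply: measurable_fun_ler; [exact: measurable_fst|exact: measurable_snd].
- by apply: measurable_maxr => //; exact: measurable_fst.
Qed.

Lemma measurable_payment {R : realType} (x : R) : measurable_fun setT (payment^~ x).
Proof.
rewrite /payment; apply: measurable_fun_ifT => //.
- exact: measurable_fun_ler.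
- exact: measurable_maxr.
Qed.

Lemma integral_payment_le {R : realType} (A : probability R R) (x : R) :
  (\int[A]_p (payment p x)%:E <= `|x|%:E)%E.
Proof.
rewrite -[leRHS]mule1 -(probability_setT A) -integral_cst //.
apply: ge0_le_integral => //.
- by move=> p _; rewrite lee_fin payment_ge0.
- by apply/measurable_EFinP; exact: measurable_payment.
- by move=> p _; rewrite lee_fin payment_le.
Qed.

(** The integral lies between 0 and |x|, so [fine] loses nothing. *)
Lemma mean_paymentE {R : realType} (A : probability R R) (x : R) :
  (mean_payment A x)%:E = (\int[A]_p (payment p x)%:E)%E.
Proof.
rewrite /mean_payment fineK // ge0_fin_numE.
  by rewrite (le_lt_trans (integral_payment_le A x)) // ltry.
by apply: integral_ge0 => p _; rewrite lee_fin payment_ge0.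
Qed.

Lemma mean_payment_ge0 {R : realType} (A : probability R R) (x : R) :
  0 <= mean_payment A x.
Proof.
by apply: fine_ge0; apply: integral_ge0 => p _; rewrite lee_fin payment_ge0.
Qed.

Lemma measurable_mean_payment {R : realType} (A : probability R R) :
  measurable_fun setT (mean_payment A).
Proof.
apply/measurable_EFinP.
rewrite (_ : EFin \o _ = fubini_G A (fun z => (payment z.1 z.2)%:E)).
  apply: measurable_fun_fubini_tonelli_G => //=.
    by apply/measurable_EFinP; exact: measurable_payment2.
  by move=> z; rewrite lee_fin payment_ge0.
by apply/funext => x /=; rewrite mean_paymentE.
Qed.

Lemma mean_payment_mono {R : realType} (A : probability R R) (x y : R) :
  x <= y -> mean_payment A x <= mean_payment A y.
Proof.
move=> xy; rewrite -lee_fin !mean_paymentE; apply: ge0_le_integral => //.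
- by move=> p _; rewrite lee_fin payment_ge0.
- by apply/measurable_EFinP; exact: measurable_payment.
- by apply/measurable_EFinP; exact: measurable_payment.
move=> p _; rewrite lee_fin /payment; case: ifPn => [px|_].
  by rewrite (le_trans px xy).
by case: ifP => // _; rewrite le_max lexx orbT.
Qed.

(* A price in (x, y] is at least x and is paid by a buyer of value y but not
   by one of value x. *)
Lemma mean_payment_increment {R : realType} (A : probability R R) (x y : R) :
  0 <= x -> x <= y ->
  x * fine (A `]x, y]%classic) <= mean_payment A y - mean_payment A x.
Proof.
move=> x0 xy; rewrite lerBrDl -lee_fin EFinD EFinM !mean_paymentE.
rewrite fineK ?fin_num_measure //.
have -> : (x%:E * A `]x, y]%classic = \int[A]_p (x%:E * (\1_`]x, y]%classic p)%:E))%E.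
  rewrite ge0_integralZl_EFin //.
    by rewrite integral_indic // setIT.
  by apply/measurable_EFinP; exact: measurable_indic.
rewrite -ge0_integralD //.
- apply: ge0_le_integral => //.
  + by move=> p _; rewrite -EFinM -EFinD lee_fin addr_ge0 ?payment_ge0 ?mulr_ge0.
  + apply: emeasurable_funD; first by apply/measurable_EFinP; exact: measurable_payment.
    by apply: measurable_funeM; apply/measurable_EFinP; exact: measurable_indic.
  + by apply/measurable_EFinP; exact: measurable_payment.
  + move=> p _; rewrite -EFinM -EFinD lee_fin /payment indicE.
    have [px|xp] := leP p x.
      rewrite (le_trans px xy) memNset ?mulr0 ?addr0 //= in_itv /=.
      by rewrite ltNge px.
    rewrite add0r; have [py|yp] := leP p y.
      rewrite mem_set ?mulr1; last by rewrite /= in_itv /= xp py.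
      by rewrite le_max (ltW xp).
    by rewrite memNset ?mulr0 //= in_itv /= [p <= y]leNgt yp andbF.
- by move=> p _; rewrite lee_fin payment_ge0.
- by apply/measurable_EFinP; exact: measurable_payment.
- by move=> p _; rewrite -EFinM lee_fin mulr_ge0.
- by apply: measurable_funeM; apply/measurable_EFinP; exact: measurable_indic.
Qed.

(** * Revenue as the mean over values of the expected payment *)

Lemma integral_REVp {R : realType} (A F : probability R R) : A `]-oo, 0[%classic = 0%E ->
  (\int[A]_p (REVp p F)%:E = \int[F]_x (mean_payment A x)%:E)%E.
Proof.
move=> A0.
have paymentE p : (\int[F]_x (payment p x)%:E)%E = (Num.max p 0 * fine (F `[p, +oo[%classic))%:E.
  rewrite EFinM fineK ?fin_num_measure //.
  rewrite (_ : F `[p, +oo[%classic = \int[F]_x (\1_`[p, +oo[%classic x)%:E)%E; last first.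
    by rewrite integral_indic // setIT.
  rewrite -ge0_integralZl_EFin //; last 2 first.
  - by apply/measurable_EFinP; exact: measurable_indic.
  - by rewrite le_max lexx orbT.
  apply: eq_integral => x _; rewrite -EFinM /payment indicE.
  have [px|xp] := leP p x; first by rewrite mem_set ?mulr1 //= in_itv /= px.
  by rewrite memNset ?mulr0 //= in_itv /= leNgt xp.
under [RHS]eq_integral do rewrite mean_paymentE.
rewrite -(@fubini_tonelli _ _ _ _ _ A F (fun z => (payment z.1 z.2)%:E)) /=.
- have mtail : measurable_fun setT (fun p : R => fine (F `[p, +oo[%classic)).
    apply: nonincreasing_measurable => // p q pq.
    rewrite fine_le ?fin_num_measure // le_measure ?inE //.
    by apply: subset_itvr; rewrite bnd_simp.
  under [RHS]eq_integral do rewrite paymentE.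
  apply: ae_eq_integral => //.
  + by apply/measurable_EFinP; apply: measurable_funM.
  + by apply/measurable_EFinP; apply: measurable_funM => //; exact: measurable_maxr.
  (* The truncated and the actual price differ only on negative prices, a null set for [A]. *)
  exists `]-oo, 0[%classic; split => //= p /= pE; rewrite in_itv /= ltNge; apply/negP => p0.
  by apply: pE => _; rewrite /REVp max_l.
- by apply/measurable_EFinP; exact: measurable_payment2.
- by move=> z; rewrite lee_fin payment_ge0.
Qed.

(** * Integrability and Markov's bound on the optimal revenue *)

Lemma mean_payment_le_norm {R : realType} (A : probability R R) (x : R) :
  mean_payment A x <= `|x|.
Proof. by rewrite -lee_fin mean_paymentE integral_payment_le. Qed.

Lemma in_class_integrable_sq {R : realType} (mu sigma : R) (F : probability R R) :
  in_class mu sigma F -> F.-integrable setT (fun x : R => ((x - mu) ^+ 2)%:E).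
Proof.
move=> [_ [_ var]]; apply/integrableP; split.
  by apply/measurable_EFinP; apply: measurable_funX; apply: measurable_funB.
under eq_integral do rewrite gee0_abs ?lee_fin ?sqr_ge0 //.
by rewrite (le_lt_trans var) // ltry.
Qed.

(** |x| is dominated by (x - mu)^2 + |mu| + 1, since t <= t^2 + 1 for t = |x - mu|. *)
Lemma in_class_integrable {R : realType} (mu sigma : R) (F : probability R R) :
  in_class mu sigma F -> F.-integrable setT (fun x : R => x%:E).
Proof.
move=> /in_class_integrable_sq isq.
have i1 : F.-integrable setT (EFin \o cst (`|mu| + 1)).
  exact: finite_measure_integrable_cst.
apply: le_integrable (integrableD measurableT isq i1) => //.
  by apply/measurable_EFinP.
move=> x _ /=; rewrite lee_fin [leRHS]ger0_norm; last first.
  by rewrite addr_ge0 ?sqr_ge0 // addr_ge0.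
have : `|x| <= `|x - mu| + `|mu| by rewrite -{1}(subrK mu x) ler_normD.
rewrite -[(x - mu) ^+ 2]real_normK ?num_real //.
have := sqr_ge0 (`|x - mu| - 1).
have := normr_ge0 (x - mu).
nra.
Qed.

(** Markov's inequality: p times the indicator of x >= p is at most |x|, which equals x almost
    everywhere under [F]. *)
Lemma REVp_le_mean {R : realType} (mu sigma : R) (F : probability R R) (p : R) :
  in_class mu sigma F -> 0 <= p -> REVp p F <= mu.
Proof.
move=> Fc p0; have [F0 [Fmu _]] := Fc.
rewrite -lee_fin /REVp EFinM fineK ?fin_num_measure //.
rewrite (_ : F `[p, +oo[%classic = \int[F]_x (\1_`[p, +oo[%classic x)%:E)%E; last first.
  by rewrite integral_indic // setIT.
rewrite -ge0_integralZl_EFin //; last first.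
  by apply/measurable_EFinP; exact: measurable_indic.
have <- : (\int[F]_x `|x|%:E = mu%:E)%E.
  rewrite -Fmu; apply: ae_eq_integral => //.
    by apply/measurable_EFinP; exact: normr_measurable.
  exists `]-oo, 0[%classic; split => //= x /= xE.
  rewrite in_itv /= ltNge; apply/negP => x0; apply: xE => _.
  by rewrite ger0_norm.
apply: ge0_le_integral => //.
- by move=> x _; rewrite -EFinM lee_fin mulr_ge0.
- by apply: measurable_funeM; apply/measurable_EFinP; exact: measurable_indic.
- by apply/measurable_EFinP; exact: normr_measurable.
move=> x _; rewrite -EFinM lee_fin indicE.
have [px|xp] := leP p x.
  by rewrite mem_set ?mulr1 ?(le_trans px) ?ler_norm //= in_itv /= px.
by rewrite memNset ?mulr0 //= in_itv /= leNgt xp.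
Qed.

Lemma OPT_le_mean {R : realType} (mu sigma : R) (F : probability R R) :
  in_class mu sigma F -> OPT F <= mu.
Proof.
move=> Fc; apply: ge_sup.
  by exists (REVp 0 F), 0 => //=; rewrite in_itv /= lexx.
by move=> _ /= [p + <-]; rewrite in_itv /= andbT; exact: REVp_le_mean Fc.
Qed.

Lemma integrable_mean_payment {R : realType} (mu sigma : R) (A F : probability R R) :
  in_class mu sigma F -> F.-integrable setT (fun x => (mean_payment A x)%:E).
Proof.
move=> /in_class_integrable ix; apply: le_integrable ix => //.
  by apply/measurable_EFinP; exact: measurable_mean_payment.
by move=> x _; rewrite lee_fin ger0_norm ?mean_payment_ge0 ?mean_payment_le_norm.
Qed.

Lemma REVE {R : realType} (mu sigma : R) (A F : probability R R) :
  A `]-oo, 0[%classic = 0%E -> in_class mu sigma F ->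
  (REV A F)%:E = (\int[F]_x (mean_payment A x)%:E)%E.
Proof.
move=> A0 Fc; rewrite /REV integral_REVp // fineK //.
exact: integrable_fin_num (integrable_mean_payment _ _ A F Fc).
Qed.

(** * Revenue bounds from mean and variance *)

(* A quadratic minorant of the mean payment only sees the first two moments
   of the valuation. *)
Lemma REV_ge_quadratic {R : realType} (mu sigma a b c : R) (A F : probability R R) :
  A `]-oo, 0[%classic = 0%E -> in_class mu sigma F -> 0 <= c ->
  (forall x, a + b * (x - mu) - c * (x - mu) ^+ 2 <= mean_payment A x) ->
  a - c * sigma ^+ 2 <= REV A F.
Proof.
move=> A0 Fc c0 qle; have [_ [Fmu var]] := Fc.
have isq := in_class_integrable_sq _ _ _ Fc.
have ix := in_class_integrable _ _ _ Fc.
have ic k : F.-integrable setT (EFin \o cst k) by exact: finite_measure_integrable_cst.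
(* The affine part is regrouped as (a - b mu) + b x, whose mean is a. *)
have ibx := integrableZl measurableT b ix.
have iq1 := integrableD measurableT (ic (a - b * mu)) ibx.
have iq2 := integrableZl measurableT c isq.
have iq := integrableB measurableT iq1 iq2.
have intq := integralB measurableT iq1 iq2.
move: intq; rewrite (integralD measurableT (ic (a - b * mu)) ibx).
rewrite (integralZl measurableT ix) (integralZl measurableT isq).
have -> : (\int[F]_x (EFin \o cst (a - b * mu)%R) x = (a - b * mu)%:E)%E.
  by rewrite -[RHS]mule1 -(probability_setT F) -integral_cst.
rewrite Fmu => intq.
have : (\int[F]_x (mean_payment A x)%:E >= (a - b * mu)%:E + b%:E * mu%:E
   - c%:E * \int[F]_x ((x - mu) ^+ 2)%:E)%E.
  rewrite -intq; apply: le_integral => //.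
    exact: integrable_mean_payment Fc.
  move=> x _.
  rewrite [leLHS](_ : _ = (a - b * mu + b * x - c * (x - mu) ^+ 2)%:E) // lee_fin.
  by apply: le_trans (qle x); lra.
rewrite -(REVE _ _ _ _ A0 Fc) -(fineK (integrable_fin_num measurableT isq)).
move: var; rewrite -(fineK (integrable_fin_num measurableT isq)).
set v := fine _; rewrite lee_fin => var.
rewrite [leLHS](_ : _ = (a - b * mu + b * mu - c * v)%:E) // lee_fin.
have := ler_wpM2l c0 var; lra.
Qed.

(** Zero variance forces x = mu almost everywhere under [F], so the mean payment is almost
    everywhere constant. *)
Lemma REV_point_mass {R : realType} (mu : R) (A F : probability R R) :
  A `]-oo, 0[%classic = 0%E -> in_class mu 0 F -> REV A F = mean_payment A mu.
Proof.
move=> A0 Fc; have [_ [_ var]] := Fc.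
have sq0 : (\int[F]_x `|((x - mu) ^+ 2)%:E| = 0)%E.
  under eq_integral do rewrite gee0_abs ?lee_fin ?sqr_ge0 //.
  apply/eqP; rewrite eq_le; move: var; rewrite expr0n /= => -> /=.
  by apply: integral_ge0 => x _; rewrite lee_fin sqr_ge0.
have msq : measurable_fun setT (fun x : R => ((x - mu) ^+ 2)%:E).
  by apply/measurable_EFinP; apply: measurable_funX; apply: measurable_funB.
have [N [mN N0 sN]] := (ae_eq_integral_abs F measurableT msq).1 sq0.
apply: EFin_inj; rewrite (REVE _ _ _ _ A0 Fc).
rewrite (ae_eq_integral (cst (mean_payment A mu)%:E)) //.
- by rewrite -[RHS]mule1 -(probability_setT F) -integral_cst.
- by apply/measurable_EFinP; exact: measurable_mean_payment.
exists N; split => // x /= xE; apply: sN => /= xmu; apply: xE => _.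
by have /eqP := xmu I; rewrite eqe sqrf_eq0 subr_eq0 => /eqP ->.
Qed.

(** * The log-lottery and its parabola *)

(** This is ln (1 + t) <= t at t = x / y - 1. *)
Lemma ler_ln_sub {R : realType} (x y : R) : 0 < x -> 0 < y -> 1 - x / y <= ln y - ln x.
Proof.
move=> x0 y0; have := @le_ln1Dx R (x / y - 1).
have -> : 1 + (x / y - 1) = x / y by ring.
rewrite ln_div ?posrE //; have := divr_gt0 x0 y0; lra.
Qed.

(** With l = ln (pi2 / pi1) > 0, the strict bound 1 - l < e^(-l) = pi1 / pi2 is multiplied by
    pi2. *)
Lemma log_lottery_norm_gt0 {R : realType} (pi1 pi2 : R) : 0 < pi1 -> pi1 < pi2 ->
  0 < pi2 * ln (pi2 / pi1) - (pi2 - pi1).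
Proof.
move=> p1 p12; have p2 := lt_trans p1 p12.
have q0 : 0 < pi2 / pi1 by rewrite divr_gt0.
have l0 : 0 < ln (pi2 / pi1) by rewrite ln_gt0 // ltr_pdivlMr // mul1r.
have := @expR_gt1Dx R (- ln (pi2 / pi1)).
rewrite oppr_eq0 gt_eqF // expRN lnK ?posrE // invf_div => /(_ isT).
rewrite -(ltr_pM2l p2) mulrCA divff ?gt_eqF // mulr1; lra.
Qed.

Section LogLottery.
Variables (R : realType) (pi1 pi2 : R) (A : probability R R).
Hypothesis pi1_gt0 : 0 < pi1.
Hypothesis A_cdf : forall x : R, A `]-oo, x]%classic = (log_cdf pi1 pi2 x)%:E.

Lemma log_lottery_itvoc (x y : R) : x <= y ->
  fine (A `]x, y]%classic) = log_cdf pi1 pi2 y - log_cdf pi1 pi2 x.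
Proof.
move=> xy; apply: EFin_inj; rewrite fineK ?fin_num_measure // EFinB -!A_cdf.
have -> : `]x, y]%classic = `]-oo, y]%classic `\` `]-oo, x]%classic.
  apply/seteqP; split => z /=; rewrite !in_itv /=.
    by move=> /andP[xz zy]; split => //; rewrite leNgt xz.
  by move=> [zy /negP]; rewrite -ltNge => ->.
rewrite measureD //; last by rewrite -ge0_fin_numE ?fin_num_measure.
congr (_ - A _)%E; apply/setIidPr => z /=; rewrite !in_itv /=.
by move=> /le_trans; apply.
Qed.

Lemma log_lottery_nneg : A `]-oo, 0[%classic = 0%E.
Proof.
apply/eqP; rewrite eq_le measure_ge0 andbT.
have -> : 0%E = A `]-oo, 0]%classic by rewrite A_cdf /log_cdf pi1_gt0.
by rewrite le_measure ?inE //; apply: subset_itvl; rewrite bnd_simp.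
Qed.

Lemma degenerate_mean_payment : pi2 = pi1 -> pi1 <= mean_payment A pi1.
Proof.
move=> p21; rewrite leNgt; apply/negP => lt1.
have P0 := mean_payment_ge0 A pi1.
(* All the mass lies in (x, pi1], so a buyer of value pi1 pays at least x on average; the midpoint
   exceeds the supposed payment. *)
pose x := (mean_payment A pi1 + pi1) / 2.
have x0 : 0 <= x by rewrite /x; lra.
have xlt : x < pi1 by rewrite /x; lra.
have := mean_payment_increment A x pi1 x0 (ltW xlt).
rewrite log_lottery_itvoc ?(ltW xlt) // /log_cdf p21 ltxx lexx xlt subr0 mulr1.
have := mean_payment_ge0 A x; rewrite /x; lra.
Qed.

Hypothesis pi12 : pi1 < pi2.
Let D := pi2 * ln (pi2 / pi1) - (pi2 - pi1).
Let D_gt0 : 0 < D := log_lottery_norm_gt0 pi1 pi2 pi1_gt0 pi12.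

(** The interior formula also holds at [pi2], where numerator and denominator agree. *)
Lemma log_cdfE (x : R) : pi1 <= x -> x <= pi2 ->
  log_cdf pi1 pi2 x = (pi2 * (ln x - ln pi1) - (x - pi1)) / D.
Proof.
move=> p1x xp2; rewrite /log_cdf ltNge p1x /=.
have x0 : 0 < x := lt_le_trans pi1_gt0 p1x.
have p20 : 0 < pi2 := lt_trans pi1_gt0 pi12.
case: ifPn => [p2x|_]; last by rewrite ln_div ?posrE.
have -> : x = pi2 by apply/eqP; rewrite eq_le xp2.
by rewrite -ln_div ?posrE // divff // gt_eqF.
Qed.

(* Where the lottery has density (pi2 / p - 1) / D, the mean payment has
   derivative (pi2 - x) / D. *)
Lemma mean_payment_ge_quadratic (x : R) :
  (pi2 * (x - pi1) - (x ^+ 2 - pi1 ^+ 2) / 2) / D <= mean_payment A x.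
Proof.
pose q z := (pi2 * (z - pi1) - (z ^+ 2 - pi1 ^+ 2) / 2) / D; rewrite -/(q x).
have p20 : 0 < pi2 := lt_trans pi1_gt0 pi12.
have mid y : pi1 <= y -> y <= pi2 -> q y <= mean_payment A y.
  move=> p1y yp2; rewrite -subr_ge0.
  apply: (@le_trans _ _ (mean_payment A pi1 - q pi1)).
    by rewrite /q !subrr mulr0 !mul0r subrr mul0r subr0 mean_payment_ge0.
  (* On [u, v] the second-order loss is at most pi2 (v - u)^2 / (v D), and v >= pi1 yields the
     uniform constant. *)
  apply: (@quadratic_defect_le R (fun z => mean_payment A z - q z) (pi2 / pi1 / D)) => //.
  move=> u v p1u uv vy.
  have u0 : 0 < u := lt_le_trans pi1_gt0 p1u.
  have v0 : 0 < v := lt_le_trans u0 uv.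
  have vp2 := le_trans vy yp2.
  have p1v := le_trans p1u uv.
  have up2 := le_trans uv vp2.
  have := mean_payment_increment A u v (ltW u0) uv.
  rewrite log_lottery_itvoc // !log_cdfE //.
  suff : - (pi2 / pi1 / D * (v - u) ^+ 2) + (q v - q u) <=
    u * ((pi2 * (ln v - ln pi1) - (v - pi1)) / D -
         (pi2 * (ln u - ln pi1) - (u - pi1)) / D) by lra.
  (* The logarithmic increment ln v - ln u is replaced by its lower bound 1 - u / v. *)
  apply: (@le_trans _ _ (u * (pi2 * (1 - u / v) - (v - u)) / D)); last first.
    rewrite -mulrBl -mulrA ler_pM2l // ler_pM2r ?invr_gt0 //.
    have := ler_wpM2l (ltW p20) (ler_ln_sub u v u0 v0); lra.
  rewrite -subr_ge0.
  have -> : u * (pi2 * (1 - u / v) - (v - u)) / D -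
    (- (pi2 / pi1 / D * (v - u) ^+ 2) + (q v - q u)) =
    (v - u) ^+ 2 / D * (pi2 * (pi1^-1 - v^-1) + 1 / 2).
    by rewrite /q; field; rewrite !gt_eqF.
  apply: mulr_ge0; first by rewrite divr_ge0 ?sqr_ge0 // ltW.
  rewrite addr_ge0 // mulr_ge0 ?(ltW p20) // subr_ge0 lef_pV2 ?posrE //.
(* Left of [pi1] the parabola is nonpositive: its roots are pi1 and 2 pi2 - pi1. *)
have [xp1|p1x] := leP x pi1.
  apply: le_trans (mean_payment_ge0 A x).
  apply: mulr_le0_ge0; last by rewrite invr_ge0 ltW.
  have : 0 <= (pi1 - x) * (2 * pi2 - x - pi1).
    apply: mulr_ge0; first by rewrite subr_ge0.
    by have p12 := pi12; lra.
  lra.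
have [xp2|p2x] := leP x pi2; first by rewrite mid // ltW.
(* Beyond [pi2], the vertex, the parabola stays below its maximum while the mean payment does not
   decrease. *)
apply: le_trans (mean_payment_mono A pi2 x (ltW p2x)).
apply: le_trans (mid pi2 (ltW pi12) (lexx _)).
rewrite /q ler_pM2r ?invr_gt0 //; have := sqr_ge0 (x - pi2); lra.
Qed.

End LogLottery.

(** * The approximation ratio of the log-lottery *)

Theorem theorem2 (R : realType) (mu sigma : R) :
  0 < mu -> 0 <= sigma ->
  forall rho : R, 0 < rho ->
    (rho ^+ 2)^-1 * (2 * expR (rho - 1) - 1) = (sigma / mu) ^+ 2 + 1 ->
  forall pi1 pi2 : R, 0 < pi1 -> pi1 <= pi2 ->
    pi1 * (1 + ln (pi2 / pi1)) = mu ->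
    pi1 * (2 * pi2 - pi1) = mu ^+ 2 + sigma ^+ 2 ->
  forall A : probability R R,
    (forall x : R, A `]-oo, x]%classic = (log_cdf pi1 pi2 x)%:E) ->
    (forall F : probability R R, in_class mu sigma F ->
       (rev_ratio (OPT F) (REV A F) <= rho%:E)%E) /\
    (APX mu sigma <= rho%:E)%E.
Proof.
move=> mu0 sigma0 rho rho0 rhoE pi1 pi2 p1 p12 muE sigmaE A A_cdf.
have A0 := log_lottery_nneg R pi1 pi2 A p1 A_cdf.
(* Since e^(mu / pi1 - 1) = pi2 / pi1, the left-hand side at mu / pi1 equals pi1 (2 pi2 - pi1) /
   mu^2. *)
have rhopi : rho = mu / pi1.
  have x0 : 0 < mu / pi1 by rewrite divr_gt0.
  have xE : ratio_fun (mu / pi1) = ratio_fun rho.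
    have lnE : mu / pi1 - 1 = ln (pi2 / pi1) by rewrite -muE; field; exact: lt0r_neq0.
    rewrite [RHS]rhoE /ratio_fun lnE lnK ?posrE ?divr_gt0 ?(lt_le_trans p1) //.
    transitivity (pi1 * (2 * pi2 - pi1) / mu ^+ 2); last first.
      by rewrite sigmaE; field; rewrite gt_eqF.
    by field; rewrite !lt0r_neq0.
  have [lt|lt|//] := ltgtP rho (mu / pi1).
    by have := ratio_fun_mono _ _ rho0 lt; rewrite xE ltxx.
  by have := ratio_fun_mono _ _ x0 lt; rewrite xE ltxx.
have REV_ge F : in_class mu sigma F -> pi1 <= REV A F.
  move=> Fc; move: p12; rewrite le_eqVlt => /predU1P[p12|p12].
    have mu1 : mu = pi1 by rewrite -muE -p12 divff ?gt_eqF // ln1 addr0 mulr1.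
    have s0 : sigma = 0.
      apply/eqP; rewrite -sqrf_eq0; apply/eqP; move: sigmaE; rewrite -p12 mu1; lra.
    rewrite s0 in Fc; rewrite (REV_point_mass _ _ _ A0 Fc) mu1.
    exact: degenerate_mean_payment.
  have D0 := log_lottery_norm_gt0 _ _ p1 p12.
  set D := _ - _ in D0.
  (* The right-hand side is q(mu) - sigma^2 / (2 D), the mean of q at variance exactly sigma^2. *)
  have -> : pi1 = (pi2 * (mu - pi1) - (mu ^+ 2 - pi1 ^+ 2) / 2) / D -
      (2 * D)^-1 * sigma ^+ 2.
    have -> : sigma ^+ 2 = pi1 * (2 * pi2 - pi1) - mu ^+ 2 by rewrite sigmaE; ring.
    have num : pi2 * mu - 2 * pi1 * pi2 + pi1 ^+ 2 = pi1 * D.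
      by rewrite -muE /D; ring.
    rewrite -[LHS](mulfK (lt0r_neq0 D0)) -num; field; exact: lt0r_neq0.
  (* Taylor coefficients of q at mu: slope (pi2 - mu) / D, quadratic coefficient -1 / (2 D). *)
  apply: (REV_ge_quadratic mu sigma _ ((pi2 - mu) / D)) => //.
    by rewrite invr_ge0 mulr_ge0 // ltW.
  move=> x; apply: le_trans (mean_payment_ge_quadratic _ _ _ _ p1 A_cdf p12 x).
  by rewrite le_eqVlt; apply/orP; left; apply/eqP; rewrite -/D; field; rewrite gt_eqF.
have ratio_le F : in_class mu sigma F -> (rev_ratio (OPT F) (REV A F) <= rho%:E)%E.
  move=> Fc; have rev1 := REV_ge F Fc; have rev0 := lt_le_trans p1 rev1.
  (* Revenue at least pi1 > 0 rules out the infinite value of the ratio. *)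
  rewrite /rev_ratio gt_eqF // lee_fin ler_pdivrMr // rhopi.
  apply: le_trans (OPT_le_mean _ _ _ Fc) _.
  by rewrite mulrAC ler_pdivlMr // ler_wpM2l // ltW.
split => //; apply: le_trans (ub_ereal_sup _).
  by apply: ereal_inf_lbound; exists A.
by move=> _ [F [Fc ->]]; exact: ratio_le.
Qed.
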